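(* Let $d\ge 2$ and let $s=x_{\sigma_1}\cdot\ldots\cdot x_{\sigma_m}\cdot\overline s\in\Sigma_d$, where $\sigma_1,\dots,\sigma_m\in\mathcal S_d$ and $\overline s\in S_{T_d}$. For $j=1,\dots,m$ let $\sigma_{j,0}$ be the canonical representative of the type $t(\sigma_j)$, and put $\sigma=(\sigma_{1,0}\cdots\sigma_{m,0})^{-1}\alpha(s)\in\mathcal S_d$. If $(\mathcal S_d)_s=\mathcal S_d$ and $ln(\overline s)=k\geq 3(d-1)$, then $$s=x_{\sigma_{1,0}}\cdot\ldots\cdot x_{\sigma_{m,0}}\cdot r(x_\sigma)\cdot h_{d,g},\qquad g=\frac{k-l_t(\sigma)}{2}-d+1 .$$
   Context: $\mathcal S_d$ is the symmetric group on $\{1,\dots,d\}$; permutations act on the right (products are read from left to right), and $(i_1,\dots,i_k)$ sends $i_1\mapsto i_2\mapsto\dots\mapsto i_k\mapsto i_1$. $\Sigma_d$ is the semigroup with unit generated by letters $x_\sigma$, $\sigma\in\mathcal S_d$, subject to $x_{\sigma_1}\cdot x_{\sigma_2}=x_{\sigma_2}\cdot x_{\sigma_2^{-1}\sigma_1\sigma_2}$ and $x_{\sigma_1}\cdot x_{\sigma_2}=x_{\sigma_1\sigma_2\sigma_1^{-1}}\cdot x_{\sigma_1}$, with $x_{\mathbf 1}$ equal to the unit. $\alpha:\Sigma_d\to\mathcal S_d$ is the homomorphism $x_\sigma\mapsto\sigma$. For $s=x_{\sigma_1}\cdot\ldots\cdot x_{\sigma_n}$ with all $\sigma_i\neq\mathbf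 1$, the length is $ln(s)=n$, and for any $s=x_{\sigma_1}\cdot\ldots\cdot x_{\sigma_n}$, $(\mathcal S_d)_s$ is the subgroup of $\mathcal S_d$ generated by $\sigma_1,\dots,\sigma_n$; both depend only on $s$. $T_d$ is the set of transpositions, and $S_{T_d}\subset\Sigma_d$ is the subsemigroup (with unit) generated by the $x_\tau$, $\tau\in T_d$. If $\sigma$ is a product of disjoint cycles of lengths $k_1\ge\dots\ge k_m\ge2$ (fixed points omitted), its type is $t(\sigma)=[k_1,\dots,k_m]$ and its transposition length is $l_t(\sigma)=\sum_i k_i-m$. The canonical representative of the type $[k_1,\dots,k_m]$ is $(1,\dots,k_1)(k_1+1,\dots,k_1+k_2)\cdots(\sum_{i<m}k_i+1,\dots,\sum_{i\le m}k_i)$. The regenerating homomorphism $r:\Sigma_d\to S_{T_d}$ is the unique homomorphism with $\alpha(r(x_\sigma))=\sigma$ and $ln(r(x_\sigma))=l_t(\sigma)$ for all $\sigma\in\mathcal S_d$, and $r|_{S_{T_d}}=\mathrm{Id}$. The Hurwitz element of genus $g$ is $h_{d,g}=x_{(1,2)}^{2(g+1)}\cdot x_{(2,3)}^2\cdot\ldots\cdot x_{(d-1,d)}^2$. *)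

(* Defs.v *)
From HB Require Import structures.
From mathcomp Require Import all_boot all_fingroup all_algebra.
From mathcomp Require Import boolp zify.

Set Implicit Arguments.
Unset Strict Implicit.
Unset Printing Implicit Defensive.

Local Open Scope group_scope.
Local Open Scope quotient_scope.

(* The product of 'S_d is read from left to right: (a * b) x = b (a x). *)
Inductive sigma_rel (d : nat) : seq 'S_d -> seq 'S_d -> Prop :=
  | SigmaConjR (a b : 'S_d) : sigma_rel [:: a; b] [:: b; b^-1 * a * b]
  | SigmaConjL (a b : 'S_d) : sigma_rel [:: a; b] [:: a * b * a^-1; a]
  | SigmaUnit : sigma_rel [:: 1] [::].

Inductive sigma_cong (d : nat) : seq 'S_d -> seq 'S_d -> Prop :=
  | SigmaRel u v : sigma_rel u v -> sigma_cong u v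
  | SigmaRefl u : sigma_cong u u
  | SigmaSym u v : sigma_cong u v -> sigma_cong v u
  | SigmaTrans u v w : sigma_cong u v -> sigma_cong v w -> sigma_cong u w
  | SigmaCat u u' v v' :
      sigma_cong u u' -> sigma_cong v v' -> sigma_cong (u ++ v) (u' ++ v').

Definition sigma_eqb (d : nat) : rel (seq 'S_d) :=
  fun u v => `[< sigma_cong u v >].

Lemma sigma_eqb_equiv (d : nat) : equiv_class_of (@sigma_eqb d).
Proof.
split=> [u|u v|v u w]; first exact/asboolP/SigmaRefl.
- by apply/asboolP/asboolP; exact: SigmaSym.
- by move=> /asboolP uv /asboolP vw; apply/asboolP/(SigmaTrans uv vw).
Qed.

Canonical sigma_equiv (d : nat) : equiv_rel (seq 'S_d) :=
  EquivRelPack (sigma_eqb_equiv d).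

Definition Sigma (d : nat) := {eq_quot (sigma_equiv d)}.
HB.instance Definition _ (d : nat) :
  EqQuotient (seq 'S_d) (sigma_equiv d) (Sigma d) := EqQuotient.on (Sigma d).
HB.instance Definition _ (d : nat) := Choice.on (Sigma d).

(* fingroup shadows the representative function of quotient types. *)
Local Notation repr := generic_quotient.repr.

Section SigmaMonoid.
Variable d : nat.
Implicit Types (u v w : seq 'S_d) (s t : Sigma d).

Definition word w : Sigma d := \pi_(Sigma d) w.

Lemma wordP u v : word u = word v <-> sigma_cong u v.
Proof.
by split=> [/eqmodP/asboolP //|uv]; apply/eqmodP/asboolP.
Qed.

Lemma word_repr s : word (repr s) = s. Proof. exact: reprK. Qed.

Lemma repr_word w : sigma_cong (repr (word w)) w.
Proof. by apply/wordP; rewrite word_repr. Qed.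

Lemma wordW (P : Sigma d -> Prop) : (forall w, P (word w)) -> forall s, P s.
Proof. by move=> Pw s; rewrite -(word_repr s). Qed.

Definition sigma_mul s t : Sigma d := word (repr s ++ repr t).

Lemma sigma_mul_word u v : sigma_mul (word u) (word v) = word (u ++ v).
Proof. by apply/wordP/SigmaCat; exact: repr_word. Qed.

Lemma sigma_mulA : associative sigma_mul.
Proof.
elim/wordW=> u; elim/wordW=> v; elim/wordW=> w.
by rewrite !sigma_mul_word catA.
Qed.

Lemma sigma_mul1 : left_id (word [::]) sigma_mul.
Proof. by elim/wordW=> w; rewrite sigma_mul_word. Qed.

Lemma sigma_mulr1 : right_id (word [::]) sigma_mul.
Proof. by elim/wordW=> w; rewrite sigma_mul_word cats0. Qed.

End SigmaMonoid.

HB.instance Definition _ (d : nat) :=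
  isMonoid.Build (Sigma d) (@sigma_mulA d) (@sigma_mul1 d) (@sigma_mulr1 d).

Definition x_ (d : nat) (a : 'S_d) : Sigma d := word [:: a].

Section SigmaInvariants.
Variable d : nat.
Implicit Types (u v w : seq 'S_d) (s t : Sigma d).

(* alpha, ln and letter_group are computed on an arbitrary representing word;
   the lemmas *_word below say that the choice does not matter. *)
Definition alpha s : 'S_d := \prod_(a <- repr s) a.

Definition ln s : nat := count (fun a => a != 1) (repr s).

Definition letter_group s : {set 'S_d} := <<[set a in repr s]>>.

Lemma wordM u v : word u * word v = word (u ++ v).
Proof. exact: sigma_mul_word. Qed.

Lemma word1 : word [::] = 1 :> Sigma d. Proof. by []. Qed.

Lemma wordE w : word w = \prod_(a <- w) x_ a.
Proof.
by elim: w => [|a w IHw]; rewrite ?big_nil // big_cons -IHw wordM.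
Qed.

Lemma x_1 : x_ 1 = 1 :> Sigma d.
Proof. exact/wordP/SigmaRel/SigmaUnit. Qed.

Lemma x_conjR (a b : 'S_d) : x_ a * x_ b = x_ b * x_ (b^-1 * a * b).
Proof. by rewrite !wordM; apply/wordP/SigmaRel/SigmaConjR. Qed.

Lemma x_conjL (a b : 'S_d) : x_ a * x_ b = x_ (a * b * a^-1) * x_ a.
Proof. by rewrite !wordM; apply/wordP/SigmaRel/SigmaConjL. Qed.

Lemma sigma_cong_prod u v :
  sigma_cong u v -> \prod_(a <- u) a = \prod_(a <- v) a.
Proof.
elim=> {u v}[u v []|//|u v _ -> //|u v w _ -> //|u u' v v' _ IHu _ IHv].
- by move=> a b; rewrite !big_cons !big_nil !mulg1 !mulgA mulgV mul1g.
- by move=> a b; rewrite !big_cons !big_nil !mulg1 mulgKV.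
- by rewrite !big_cons !big_nil !mulg1.
- by rewrite !big_cat /= IHu IHv.
Qed.

Lemma sigma_cong_count u v : sigma_cong u v ->
  count (fun a => a != 1) u = count (fun a => a != 1) v.
Proof.
elim=> {u v}[u v []|//|u v _ -> //|u v w _ -> //|u u' v v' _ IHu _ IHv].
- move=> a b /=; rewrite !addn0 addnC; congr (_ + ~~ _)%N.
  by rewrite -mulgA -conjgE -{2}(conj1g b) (inj_eq (conjg_inj b)).
- move=> a b /=; rewrite !addn0 addnC; congr (~~ _ + _)%N.
  rewrite -{1}[a]invgK -mulgA -conjgE -{2}(conj1g a^-1).
  by rewrite (inj_eq (conjg_inj _)).
- by rewrite /= eqxx.
- by rewrite !count_cat IHu IHv.
Qed.

Lemma sigma_cong_gen u v :
  sigma_cong u v -> <<[set a in u]>> = <<[set a in v]>>.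
Proof.
have gen2 (a b c e : 'S_d) :
    (forall G : {group 'S_d},
       (a \in G) && (b \in G) = (c \in G) && (e \in G)) ->
    <<[set x in [:: a; b]]>> = <<[set x in [:: c; e]]>>.
  have sub2 (G : {group 'S_d}) (x y : 'S_d) :
      (<<[set z in [:: x; y]]>> \subset G) = (x \in G) && (y \in G).
    rewrite gen_subG; apply/subsetP/andP=> [sG|[xG yG] z].
      by split; apply: sG; rewrite !inE eqxx ?orbT.
    by rewrite !inE => /pred2P[]->.
  move=> eqG; apply/eqP; rewrite eqEsubset.
  by rewrite sub2 eqG -sub2 subxx sub2 -eqG -sub2 subxx.
elim=> {u v}[u v []|//|u v _ -> //|u v w _ -> //|u u' v v' _ IHu _ IHv].
- move=> a b; apply: gen2 => G; rewrite andbC; case bG: (b \in G) => //=.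
  by rewrite groupMr // groupMl // groupV.
- move=> a b; apply: gen2 => G; rewrite [RHS]andbC; case aG: (a \in G) => //=.
  by rewrite groupMr ?groupV // groupMl.
- apply/eqP; rewrite eqEsubset !gen_subG; apply/andP; split.
    by apply/subsetP=> c; rewrite !inE => /eqP->; exact: group1.
  by apply/subsetP=> c; rewrite inE.
- have catE w w' : [set a in w ++ w'] = [set a in w] :|: [set a in w'].
    by apply/setP=> a; rewrite !inE mem_cat.
  by rewrite !catE -!/(joing _ _) -joing_idl -joing_idr IHu IHv
             joing_idl joing_idr.
Qed.

Lemma alpha_word w : alpha (word w) = \prod_(a <- w) a.
Proof. exact/sigma_cong_prod/repr_word. Qed.

Lemma alphaM s t : alpha (s * t) = alpha s * alpha t.
Proof.
by elim/wordW: s => u; elim/wordW: t => v; rewrite wordM !alpha_word big_cat.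
Qed.

Lemma alpha_x (a : 'S_d) : alpha (x_ a) = a.
Proof. by rewrite alpha_word big_seq1. Qed.

Lemma ln_word w : ln (word w) = count (fun a => a != 1) w.
Proof. exact/sigma_cong_count/repr_word. Qed.

Lemma letter_group_word w : letter_group (word w) = <<[set a in w]>>.
Proof. exact/sigma_cong_gen/repr_word. Qed.

End SigmaInvariants.

Definition transpositions (d : nat) : {set 'S_d} :=
  [set t | [exists i : 'I_d, exists j : 'I_d, (i != j) && (t == tperm i j)]].

Inductive in_ST (d : nat) : Sigma d -> Prop :=
  | ST_x t : t \in transpositions d -> in_ST (x_ t)
  | ST_one : in_ST 1
  | ST_mul s t : in_ST s -> in_ST t -> in_ST (s * t).

Definition cycle_type (d : nat) (a : 'S_d) : seq nat :=
  sort geq [seq k <- [seq #|c| | c : {set 'I_d} <- enum (porbits a)] | 1 < k].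

Definition l_t (d : nat) (a : 'S_d) : nat :=
  sumn (cycle_type a) - size (cycle_type a).

(* The cycle (c_1, ..., c_k) for a duplicate-free sequence c; [undup] only
   serves to make the definition total. *)
Definition cycle_perm (d : nat) (c : seq 'I_d) : 'S_d :=
  perm (can_inj (prev_next (undup_uniq c))).

(* The cycle (a+1, a+2, ..., a+k), the points 1, ..., d being represented by
   the ordinals 0, ..., d-1. *)
Definition interval_cycle (d a k : nat) : 'S_d :=
  cycle_perm [seq i : 'I_d <- enum 'I_d | a <= i < a + k].

Lemma interval_cycleE (d a k : nat) (i : 'I_d) : a + k <= d ->
  interval_cycle d a k i =
    (if a <= i < a + k then if i.+1 == (a + k)%N then a else i.+1 else i)
      :> nat.
Proof.
move=> akd; have U : uniq [seq i : 'I_d <- enum 'I_d | a <= i < a + k].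
  exact/filter_uniq/enum_uniq.
rewrite permE undup_id // -(next_map val_inj) //.
have -> : map val [seq i : 'I_d <- enum 'I_d | a <= i < a + k] = iota a k.
  have -> : iota a k = [seq x <- iota 0 d | a <= x < a + k].
    apply: (@irr_sorted_eq _ ltn); rewrite ?iota_ltn_sorted //.
    - exact: ltn_trans.
    - exact: ltnn.
    - by apply: sorted_filter (iota_ltn_sorted _ _); exact: ltn_trans.
    - by move=> x; rewrite mem_filter !mem_iota; lia.
  by rewrite -val_enum_ord filter_map.
rewrite /= next_nth mem_iota; case: ifP => // /andP[ai iak].
case: k akd iak {U} => [|k] akd iak; first by lia.
have iE : index (i : nat) (iota a k.+1) = (i - a)%N.
  have {1}-> : (i : nat) = nth 0%N (iota a k.+1) (i - a).
    by rewrite nth_iota; lia.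
  by rewrite index_uniq ?iota_uniq // size_iota; lia.
rewrite [iota _ _]/= in iE *; rewrite iE.
case: eqP => iak'; first by rewrite nth_default // size_iota; lia.
by rewrite nth_iota; lia.
Qed.

Lemma interval_cycle2 (d a : nat) (ad : a < d) (a1d : a.+1 < d) :
  interval_cycle d a 2 = tperm (Ordinal ad) (Ordinal a1d).
Proof.
apply/permP=> i; apply: ord_inj; rewrite interval_cycleE; last by lia.
case: tpermP => [->|->|/eqP + /eqP]; rewrite -?val_eqE /=;
  do 2?[case: ifP => ?]; lia.
Qed.

Definition canonical_of_type (d : nat) (ks : seq nat) : 'S_d :=
  \prod_(i < size ks) interval_cycle d (sumn (take i ks)) (nth 0%N ks i).

Definition canonical_rep (d : nat) (a : 'S_d) : 'S_d :=
  canonical_of_type d (cycle_type a).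

Definition regenerating (d : nat) (f : Sigma d -> Sigma d) : Prop :=
  [/\ forall s, in_ST (f s),
      monoid_morphism f,
      forall a : 'S_d, alpha (f (x_ a)) = a,
      forall a : 'S_d, ln (f (x_ a)) = l_t a
    & forall s, in_ST s -> f s = s].

Section Regeneration.
Variable d : nat.
Implicit Types (a b : 'S_d) (u v w : seq 'S_d) (i j p q x y : 'I_d).

Let T_word w := all [in transpositions d] w.
Let conn w x y := exists2 a, a \in <<[set b in w]>> & a x = y.

Lemma transpositionP a :
  reflect (exists i, exists2 j, i != j & a = tperm i j)
          (a \in transpositions d).
Proof.
rewrite inE; apply: (iffP existsP) => [[i /existsP[j /andP[ij /eqP->]]]|].
  by exists i, j.
by move=> [i [j ij ->]]; exists i; apply/existsP; exists j; rewrite ij eqxx.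
Qed.

Lemma tperm_transposition i j : i != j -> tperm i j \in transpositions d.
Proof. by move=> ij; apply/transpositionP; exists i, j. Qed.

Lemma transposition_neq1 a : a \in transpositions d -> a != 1.
Proof.
case/transpositionP=> i [j ij ->]; apply/eqP=> /permP/(_ i).
by rewrite tpermL perm1 => ji; rewrite ji eqxx in ij.
Qed.

Lemma transpositionJ a b :
  a \in transpositions d -> a ^ b \in transpositions d.
Proof.
case/transpositionP=> i [j ij ->]; rewrite tpermJ tperm_transposition //.
by rewrite (inj_eq perm_inj).
Qed.

Lemma T_word_count w : T_word w -> count (fun a => a != 1) w = size w.
Proof.
move=> /allP Tw; apply/eqP; rewrite -all_count; apply/allP=> a /Tw.
exact: transposition_neq1.
Qed.

Lemma T_word_size u v : T_word u -> T_word v -> sigma_cong u v ->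
  size u = size v.
Proof. by move=> Tu Tv /sigma_cong_count; rewrite !T_word_count. Qed.

Lemma sigma_cong_cons a u v :
  sigma_cong u v -> sigma_cong (a :: u) (a :: v).
Proof. exact: (@SigmaCat _ [:: a] [:: a] _ _ (SigmaRefl _)). Qed.

Lemma sigma_cong_swapR a b w :
  sigma_cong (a :: b :: w) (b :: a ^ b :: w).
Proof.
apply: (@SigmaCat _ [:: a; b] [:: b; a ^ b] w w); last exact: SigmaRefl.
by rewrite conjgE mulgA; apply/SigmaRel/SigmaConjR.
Qed.

Lemma sigma_cong_swapL a b w :
  sigma_cong (a :: b :: w) (b ^ a^-1 :: a :: w).
Proof.
apply: (@SigmaCat _ [:: a; b] [:: b ^ a^-1; a] w w); last exact: SigmaRefl.
by rewrite conjgE mulgA invgK; apply/SigmaRel/SigmaConjL.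
Qed.

Lemma conn_refl w x : conn w x x.
Proof. by exists 1; rewrite ?group1 ?perm1. Qed.

Lemma conn_sym w x y : conn w x y -> conn w y x.
Proof. by case=> a wa <-; exists a^-1; rewrite ?groupV ?permK. Qed.

Lemma conn_trans w x y z : conn w x y -> conn w y z -> conn w x z.
Proof.
by move=> [a wa <-] [b wb <-]; exists (a * b); rewrite ?groupM ?permM.
Qed.

Lemma conn_cong u v x y : sigma_cong u v -> conn u x y -> conn v x y.
Proof. by move=> /sigma_cong_gen uv [a]; rewrite uv; exists a. Qed.

Lemma conn_consW a w x y : conn w x y -> conn (a :: w) x y.
Proof.
case=> b wb <-; exists b => //; apply: subsetP wb; apply/genS/subsetP=> c.
by rewrite !inE orbC => ->.
Qed.

Lemma conn_cons p q w x y : conn (tperm p q :: w) x y ->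
  [\/ conn w x y, conn w x p /\ conn w q y | conn w x q /\ conn w p y].
Proof.
set R := fun x y => [\/ conn w x y, conn w x p /\ conn w q y
                      | conn w x q /\ conn w p y].
have Rtrans x1 x2 x3 : R x1 x2 -> R x2 x3 -> R x1 x3.
  move=> [c12|[c1p cq2]|[c1q cp2]] [c23|[c2p cq3]|[c2q cp3]].
  - exact/Or31/(conn_trans c12).
  - by apply: Or32; split=> //; apply: conn_trans c2p.
  - by apply: Or33; split=> //; apply: conn_trans c2q.
  - by apply: Or32; split=> //; apply: conn_trans c23.
  - by apply: Or32.
  - by apply: Or31; apply: conn_trans cp3.
  - by apply: Or33; split=> //; apply: conn_trans c23.
  - by apply: Or31; apply: conn_trans cq3.
  - by apply: Or33.
case=> a + <-; pose G := [set a : 'S_d | `[< forall x, R x (a x) >]].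
have gG : group_set G.
  apply/group_setP; split=> [|b c].
    by rewrite inE; apply/asboolP=> z; rewrite perm1; apply/Or31/conn_refl.
  rewrite !inE => /asboolP Rb /asboolP Rc; apply/asboolP=> z.
  by rewrite permM; apply: Rtrans (Rc _).
suff /subsetP sG : <<[set b in tperm p q :: w]>> \subset Group gG.
  by move/sG; rewrite inE => /asboolP/(_ x).
rewrite gen_subG; apply/subsetP=> b; rewrite !inE => /predU1P[->|wb].
  apply/asboolP=> z; case: tpermP => [->|->|_ _].
  - by apply: Or32; split; exact: conn_refl.
  - by apply: Or33; split; exact: conn_refl.
  - exact/Or31/conn_refl.
apply/asboolP=> z; apply: Or31; exists b => //.
by apply: mem_gen; rewrite inE.
Qed.

(* Any transposition whose two points are connected by the letters of a word
   in transpositions can be moved to the front of this word. *)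
Lemma pull_tperm w x y : T_word w -> x != y -> conn w x y ->
  exists2 w', T_word w' & sigma_cong w (tperm x y :: w').
Proof.
move: {2}(size w).+1 (ltnSn (size w)) => n.
elim: n w x y => // n IHn [|t w] x y.
  move=> _ _ xy [a]; rewrite (_ : [set _ in _] = set0) ?gen0; last first.
    by apply/setP=> b; rewrite !inE.
  by rewrite inE => /eqP-> xyE; rewrite -xyE perm1 eqxx in xy.
rewrite ltnS => szw /= /andP[/transpositionP[p [q pq ->]] Tw].
have main x0 y0 p0 q0 : x0 != y0 -> p0 != q0 -> conn w x0 p0 -> conn w q0 y0 ->
    exists2 w', T_word w' & sigma_cong (tperm p0 q0 :: w) (tperm x0 y0 :: w').
  move: x0 y0 p0 q0 => {pq}x {}y {}p {}q xy pq cxp cqy.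
  case: (pselect (conn w x y)) => [cxy|ncxy].
    have [w' Tw' ww'] := IHn _ _ _ szw Tw xy cxy.
    exists (tperm p q ^ tperm x y :: w').
      by rewrite /T_word /= transpositionJ ?tperm_transposition.
    apply: SigmaTrans (sigma_cong_swapR _ _ _); exact: sigma_cong_cons.
  have xq : x != q by apply/eqP=> xqE; apply: ncxy; rewrite xqE.
  have [w1 Tw1 [ww1 cqy1]] : exists2 w1, T_word w1 &
      sigma_cong (tperm p q :: w) (tperm x q :: w1) /\ conn w1 q y.
    have [<-|xp] := eqVneq x p.
      by exists w => //; split=> //; exact: SigmaRefl.
    have [w' Tw' ww'] := IHn _ _ _ szw Tw xp cxp.
    exists (tperm p q :: w'); first by rewrite /T_word /= tperm_transposition.
    split.
      apply: SigmaTrans (sigma_cong_cons _ ww') _.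
      apply: SigmaTrans (sigma_cong_swapL _ _ _) _.
      rewrite tpermV tpermJ tpermL tpermD 1?eq_sym //.
      exact: SigmaRefl.
    have cw'w z z' : conn w' z z' -> conn w z z'.
      by move=> c; apply: (conn_cong (SigmaSym ww')); exact: conn_consW.
    have [/conn_consW //|[/cw'w cqx _]|[_ /cw'w //]] :=
      conn_cons (conn_cong ww' cqy).
    by case: ncxy; apply: conn_trans (conn_sym cqx) cqy.
  have [qy|qy] := eqVneq q y; first by exists w1; rewrite -?qy.
  have szw1 : size w1 < n.
    suff -> : size w1 = size w by [].
    apply: succn_inj; apply/esym.
    by apply: (T_word_size _ _ ww1); rewrite /T_word /= tperm_transposition.
  have [w2 Tw2 w12] := IHn _ _ _ szw1 Tw1 qy cqy1.
  exists (tperm x q :: w2); first by rewrite /T_word /= tperm_transposition.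
  apply: SigmaTrans ww1 _; apply: SigmaTrans (sigma_cong_cons _ w12) _.
  apply: SigmaTrans (sigma_cong_swapL _ _ _) _.
  rewrite tpermV tpermJ tpermR tpermD //; exact: SigmaRefl.
move=> xy /conn_cons[cxy|[cxp cqy]|[cxq cpy]].
- have [w' Tw' ww'] := IHn _ _ _ szw Tw xy cxy.
  exists (tperm p q ^ tperm x y :: w').
    by rewrite /T_word /= transpositionJ ?tperm_transposition.
  apply: SigmaTrans (sigma_cong_swapR _ _ _); exact: sigma_cong_cons.
- exact: main.
- by rewrite tpermC; apply: main; rewrite // eq_sym.
Qed.

Lemma l_t_porbits a : (l_t a + #|porbits a|)%N = d.
Proof.
have sumE (s : seq nat) : all (leq 1) s -> let s' := [seq k <- s | 1 < k] in
    (sumn s' - size s' + size s)%N = sumn s /\ size s' <= sumn s'.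
  elim: s => [|k s IHs] //= /andP[k0 /IHs /= [sE szs]].
  by case: (ltnP 1%N k) => /=; lia.
pose s := [seq #|c| | c : {set 'I_d} <- enum (porbits a)].
have s0 : all (leq 1) s.
  apply/allP=> n /mapP[c]; rewrite mem_enum => /imsetP[x _ ->] ->.
  by rewrite lt0n card_porbit_neq0.
have sd : sumn s = d.
  rewrite sumnE big_map big_enum /= -[RHS]card_ord -sum1_card.
  rewrite (partition_big (porbit a) [in porbits a]) /=; last first.
    by move=> x _; apply: imset_f.
  apply: eq_bigr => _ /imsetP[y _ ->]; rewrite -sum1_card.
  by apply: eq_bigl => x; rewrite eq_porbit_mem.
rewrite -[RHS]sd; have [<- _] := sumE s s0; rewrite {3}/s size_map -cardE.
congr (_ + _)%N.
by rewrite /l_t /cycle_type size_sort (perm_sumn (permEl (perm_sort _ _))).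
Qed.

Lemma l_t_split p q a : p != q -> q \in porbit a p ->
  l_t a = (l_t (tperm p q * a)).+1.
Proof.
move=> pq qa; have := porbits_mul_tperm a p q; rewrite /= pq porbit_sym qa /=.
have := l_t_porbits a; have := l_t_porbits (tperm p q * a).
move: (l_t _) (l_t _) #|porbits (tperm p q * a)| #|porbits a| => l1 l2 n1 n2.
by lia.
Qed.

Lemma l_t_join p q a : p != q -> q \notin porbit a p ->
  l_t (tperm p q * a) = (l_t a).+1.
Proof.
move=> pq qa; have := porbits_mul_tperm a p q; rewrite /= pq porbit_sym qa /=.
have := l_t_porbits a; have := l_t_porbits (tperm p q * a).
move: (l_t _) (l_t _) #|porbits (tperm p q * a)| #|porbits a| => l1 l2 n1 n2.
by lia.
Qed.

Lemma prod_T_word w : T_word w -> l_t (\prod_(b <- w) b) <= size w.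
Proof.
elim: w => [_|t w IHw /= /andP[/transpositionP[p [q pq ->]] /IHw]].
  rewrite big_nil -(leq_add2r #|porbits (1 : 'S_d)|) l_t_porbits add0n.
  rewrite card_imset ?card_ord // => x y /eqP; rewrite eq_porbit_mem.
  by case/porbitP=> i; rewrite expg1n perm1.
rewrite big_cons => lew.
have [qa|qa] := boolP (q \in porbit (\prod_(b <- w) b) p).
  by apply/ltnW; rewrite ltnS; apply: leq_trans lew; rewrite (l_t_split pq qa).
by rewrite (l_t_join pq qa) ltnS.
Qed.

Lemma l_t1 : l_t (1 : 'S_d) = 0%N.
Proof.
by have := @prod_T_word [::] isT; rewrite big_nil leqn0 => /eqP.
Qed.

Lemma l_t_transposition a : a \in transpositions d -> l_t a = 1%N.
Proof.
case/transpositionP=> p [q pq ->]; rewrite -[tperm p q]mulg1 l_t_join ?l_t1 //.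
apply/negP=> /porbitP[i]; rewrite expg1n perm1 => qp.
by rewrite qp eqxx in pq.
Qed.

Lemma min_factorization a :
  exists w, [/\ T_word w, \prod_(b <- w) b = a & size w = l_t a].
Proof.
move: {2}(l_t a).+1 (ltnSn (l_t a)) => n.
elim: n a => // n IHn a; rewrite ltnS => lta.
have [->|] := eqVneq a 1.
  by exists [::]; split; rewrite ?big_nil ?l_t1.
move=> a1; have [x ax] : exists x, x != a x.
  apply/existsP; apply: contraNT a1 => /existsPn ax1; apply/eqP/permP=> x.
  by rewrite perm1; apply/esym/eqP/negbNE/ax1.
have axin : a x \in porbit a x by rewrite -{1}[a]expg1 mem_porbit.
have ltE := l_t_split ax axin.
have [|w [Tw wa szw]] := IHn (tperm x (a x) * a); first by rewrite -ltE.
exists (tperm x (a x) :: w); split.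
- by rewrite /T_word /= tperm_transposition.
- by rewrite big_cons wa mulgA tperm2 mul1g.
- by rewrite /= szw ltE.
Qed.

Lemma min_factorization_uniq u v : T_word u -> T_word v ->
  \prod_(b <- u) b = \prod_(b <- v) b -> size u = l_t (\prod_(b <- u) b) ->
  size v = size u -> sigma_cong u v.
Proof.
elim: u v => [|t u IHu] v.
  by move=> _ _ _ _ /size0nil->; exact: SigmaRefl.
rewrite [T_word _]/= => /andP[/transpositionP[p [q pq ->]] Tu] Tv.
rewrite big_cons => uv szu szv; set a := \prod_(b <- u) b in uv szu.
have := prod_T_word Tu; rewrite -/a => lta.
have qa : q \notin porbit a p.
  apply/negP=> qa; move: lta; rewrite (l_t_split pq qa) -szu /=.
  by rewrite ltnNge leqnSn.
have qpa : q \in porbit (tperm p q * a) p.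
  apply: contraT => /(l_t_join pq); rewrite mulgA tperm2 mul1g => ltE.
  by move: lta; rewrite ltE -szu /= ltnNge leqnSn.
have cv : conn v p q.
  case/porbitP: qpa => i ->; exists ((tperm p q * a) ^+ i) => //.
  by rewrite uv groupX // big_seq group_prod // => b bv; rewrite mem_gen ?inE.
have [v' Tv' vv'] := pull_tperm Tv pq cv.
have szv' : size v = (size v').+1.
  by rewrite (T_word_size Tv _ vv') //= /T_word /= tperm_transposition.
apply: SigmaTrans (SigmaSym vv'); apply/sigma_cong_cons/IHu => //.
- by apply: (mulgI (tperm p q)); rewrite uv (sigma_cong_prod vv') big_cons.
- by move: szu; rewrite (l_t_join pq qa) /= => /succn_inj.
- by move: szv; rewrite szv' /= => /succn_inj.
Qed.

Lemma in_STP (s : Sigma d) :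
  in_ST s <-> exists2 w, T_word w & s = word w.
Proof.
split=> [|[w + ->]].
  elim=> [t Tt||s1 s2 _ [w1 Tw1 ->] _ [w2 Tw2 ->]].
  - by exists [:: t]; rewrite /T_word //= Tt.
  - by exists [::].
  - by exists (w1 ++ w2); rewrite ?wordM // /T_word all_cat; apply/andP.
elim: w => [|t w IHw] /=; first by move=> _; exact: ST_one.
by case/andP=> Tt /IHw STw; rewrite -cat1s -wordM; apply: ST_mul (ST_x Tt) STw.
Qed.

Lemma sigma_cong_cat_conj u v :
  sigma_cong (u ++ v) (v ++ [seq a ^ (\prod_(b <- v) b) | a <- u]).
Proof.
elim: v u => [|b v IHv] u.
  rewrite big_nil cats0 (eq_map (@conjg1 _)) map_id; exact: SigmaRefl.
rewrite big_cons (eq_map (fun a => conjgM a _ _)) (map_comp (conjg^~ _)).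
rewrite -cat1s catA; apply: SigmaTrans (_ : sigma_cong _ _) _; last first.
  rewrite -cat1s -catA; apply: SigmaCat (SigmaRefl _) (IHv _).
rewrite catA; apply: SigmaCat (SigmaRefl _).
elim: u => [|a u IHu]; first exact: SigmaRefl.
apply: SigmaTrans (sigma_cong_cons a IHu) _; exact: sigma_cong_swapR.
Qed.

Lemma regenerating_exists : exists f, @regenerating d f.
Proof.
have /choice[m mP] := min_factorization.
pose M w := flatten [seq m a | a <- w].
have prodJ w b : (\prod_(c <- w) c) ^ b = \prod_(c <- [seq c ^ b | c <- w]) c.
  rewrite big_map; elim/big_rec2: _ => [|c y1 y2 _ <-].
    by rewrite conj1g.
  by rewrite conjMg.
have TJ w b : T_word w -> T_word [seq c ^ b | c <- w].
  by move=> /allP Tw; apply/allP=> _ /mapP[c cm ->]; apply/transpositionJ/Tw.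
have TM w : T_word (M w).
  apply/allP=> t /flattenP[_ /mapP[a _ ->]].
  by case: (mP a) => /allP + _ _; apply.
have ltJ_le a b : l_t (a ^ b) <= l_t a.
  have [Ta ma <-] := mP a; rewrite -{1}ma -(size_map (conjg^~ b)).
  rewrite prodJ; apply: prod_T_word; exact: TJ.
have ltJ a b : l_t (a ^ b) = l_t a.
  by apply/eqP; rewrite eqn_leq ltJ_le -{1}(conjgK b a) ltJ_le.
have mJ a b : sigma_cong [seq c ^ b | c <- m a] (m (a ^ b)).
  have [Ta ma sza] := mP a; have [Tb mb szb] := mP (a ^ b).
  apply: min_factorization_uniq; rewrite -?prodJ ?ma ?mb ?size_map //.
  - exact: TJ.
  - by rewrite sza ltJ.
  - by rewrite szb ltJ sza.
have mC a b : sigma_cong (m a ++ m b) (m b ++ m (a ^ b)).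
  apply: SigmaTrans (sigma_cong_cat_conj _ _) _.
  by case: (mP b) => _ -> _; apply: SigmaCat (SigmaRefl _) (mJ a b).
have m1 : m 1 = [::] by case: (mP 1) => _ _; rewrite l_t1 => /size0nil.
have Mcong u v : sigma_cong u v -> sigma_cong (M u) (M v).
  elim=> {u v}[u v []|u|u v _|u v w _ uv _|u u' v v' _ IHu _ IHv].
  - by move=> a b; rewrite /M /= !cats0 -mulgA -conjgE; exact: mC.
  - move=> a b; rewrite /M /= !cats0; apply: SigmaSym.
    have {2}-> : b = (a * b * a^-1) ^ a by rewrite conjgE mulgKV mulKg.
    exact: mC.
  - rewrite /M /= m1; exact: SigmaRefl.
  - exact: SigmaRefl.
  - exact: SigmaSym.
  - exact: SigmaTrans.
  - by rewrite /M !map_cat !flatten_cat; exact: SigmaCat.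
pose f (s : Sigma d) : Sigma d := word (M (generic_quotient.repr s)).
have fE w : f (word w) = word (M w).
  exact/wordP/Mcong/repr_word.
exists f; split.
- by elim/wordW=> w; rewrite fE; apply/in_STP; exists (M w).
- split; first by rewrite -[1 in LHS]word1 fE.
  elim/wordW=> u; elim/wordW=> v.
  by rewrite wordM !fE wordM /M map_cat flatten_cat.
- by move=> a; rewrite fE /M /= cats0 alpha_word; case: (mP a).
- move=> a; rewrite fE /M /= cats0 ln_word.
  by case: (mP a) => Ta _ <-; exact: T_word_count.
- move=> s /in_STP[w + ->]; rewrite fE => Tw; apply/wordP.
  elim: w Tw => [_|t w IHw /= /andP[Tt Tw]]; first exact: SigmaRefl.
  apply: (@SigmaCat _ (m t) [:: t]); last exact: IHw.
  have [Tmt mt szt] := mP t; apply: min_factorization_uniq; rewrite ?mt //.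
  + by rewrite /T_word /= Tt.
  + by rewrite big_seq1.
  + by rewrite szt l_t_transposition.
Qed.

Lemma regenerating_unique f f' :
  @regenerating d f -> @regenerating d f' -> f =1 f'.
Proof.
move=> [STf [f1 fM] fa fl _] [STf' [f'1 f'M] fa' fl' _].
elim/wordW; elim=> [|a w IHw]; first by rewrite word1 f1.
rewrite -cat1s -wordM fM f'M IHw; congr (_ * _).
rewrite -/(x_ a); move: (fa a) (fl a) (fa' a) (fl' a).
have /in_STP[u Tu ->] := STf (x_ a); have /in_STP[v Tv ->] := STf' (x_ a).
rewrite !alpha_word !ln_word !T_word_count // => ua uszE va vszE.
apply/wordP/min_factorization_uniq => //; first by rewrite va.
  by rewrite ua.
by rewrite uszE.
Qed.

End Regeneration.

(* regenerating_unique shows that there is nothing to choose here. *)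
Definition regen (d : nat) : Sigma d -> Sigma d :=
  projT1 (cid (regenerating_exists d)).

Lemma regenP (d : nat) : regenerating (@regen d).
Proof. exact: projT2 (cid (regenerating_exists d)). Qed.

Definition hurwitz_element (d g : nat) : Sigma d :=
  x_ (interval_cycle d 0 2) ^+ (2 * g.+1) *
  \prod_(1 <= i < d.-1) x_ (interval_cycle d i 2) ^+ 2.

(* Main.v *)
(** In Sigma_d the square x_t^2 of a transposition is central, and next to an
    element s it may be replaced by x_(t^g)^2 for every g in the group
    generated by the letters of s. A product of k transpositions equals a
    minimal factorization of its image in S_d, of length at most d - 1,
    times squares; as k >= 3(d - 1), there are at least d - 1 squares. Read
    their transpositions as the edges of a graph on the d points. As long as
    the graph is disconnected it contains an edge closing a cycle, and since
    the whole word generates S_d this edge can be conjugated into one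
    joining two components. Once the graph is connected, edges can be
    exchanged until it becomes the path 1 - 2 - ... - d with all remaining
    edges equal to (1,2), which is a Hurwitz element. The same freedom
    provides, next to any x_a, a spare transposition t to conjugate a by
    while the other transpositions still generate S_d; so each sigma_j can
    be conjugated into its canonical representative. *)
Require Import Defs.
From HB Require Import structures.
From mathcomp Require Import all_boot all_fingroup all_algebra.
From mathcomp Require Import boolp zify ring.

Set Implicit Arguments.
Unset Strict Implicit.
Unset Printing Implicit Defensive.

Local Open Scope group_scope.

Local Notation gen w := (<<[set b in w]>>).
Local Notation T_word w := (all [in transpositions _] w).

(** * Squares of transpositions *)

Section Words.
Variable d : nat.
Implicit Types (a b t : 'S_d) (u v w E F : seq 'S_d) (p q x y : 'I_d).
Implicit Types (s : Sigma d).

(** For a word in transpositions this is connectivity in the graph whose edges are its letters. *)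
Definition conn w x y := exists2 a, a \in gen w & a x = y.

(* Not [x_ t ^+ 2], which unifies with a product and so is torn apart by
   [rewrite mulgA]. *)
Definition x2 t : Sigma d := word [:: t; t].

Definition sq E : Sigma d := \prod_(t <- E) x2 t.

Lemma word_cons a w : word (a :: w) = x_ a * word w.
Proof. by rewrite /x_ wordM. Qed.

Lemma x2E t : x2 t = x_ t * x_ t.
Proof. by rewrite wordM. Qed.

Lemma gen_sub u v : {subset u <= gen v} -> gen u \subset gen v.
Proof.
by move=> uv; rewrite gen_subG; apply/subsetP=> a; rewrite inE; exact: uv.
Qed.

Lemma mem_gen_word w a : a \in w -> a \in gen w.
Proof. by move=> aw; rewrite mem_gen ?inE. Qed.

Lemma eq_gen_mem u v : u =i v -> gen u = gen v.
Proof. by move=> uv; congr <<_>>; apply/setP=> a; rewrite !inE uv. Qed.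

Lemma sub_gen_word u v : {subset u <= v} -> gen u \subset gen v.
Proof. by move=> uv; apply: gen_sub => a /uv; exact: mem_gen_word. Qed.

Lemma prod_mem_gen w : \prod_(a <- w) a \in gen w.
Proof. by rewrite big_seq group_prod // => a; exact: mem_gen_word. Qed.

Lemma transposition_sq t : t \in transpositions d -> t * t = 1.
Proof. by case/transpositionP=> i [j _ ->]; rewrite tperm2. Qed.

(** Spells [sq E] out as a word, so that its letters, length and image in ['S_d] can be read off. *)
Definition doubles E := flatten [seq [:: t; t] | t <- E].

Lemma mem_doubles E : doubles E =i E.
Proof. by elim: E => //= t E IHE a; rewrite !inE IHE orbA orbb. Qed.

Lemma sqE E : sq E = word (doubles E).
Proof.
elim: E => [|t E IHE]; first by rewrite /sq big_nil.
by rewrite /sq big_cons /= !word_cons -IHE x2E mulgA.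
Qed.

Lemma sq_nil : sq [::] = 1.
Proof. by rewrite /sq big_nil. Qed.

Lemma sq_cat E F : sq (E ++ F) = sq E * sq F.
Proof. by rewrite /sq big_cat. Qed.

Lemma sq_cons t E : sq (t :: E) = x2 t * sq E.
Proof. by rewrite /sq big_cons. Qed.

(** Crossing the two letters of the square conjugates by [t] twice, and [t] is an involution. *)
Lemma x_sq_comm t s : t \in transpositions d ->
  s * x2 t = x2 t * s.
Proof.
move=> Tt; elim/wordW: s; elim=> [|a w IHw]; first by rewrite mul1g mulg1.
rewrite word_cons -mulgA IHw !mulgA; congr (_ * _).
rewrite x2E mulgA (x_conjR a t) -[LHS]mulgA (x_conjR (_ * a * _) t) mulgA.
rewrite (_ : t^-1 * (t^-1 * a * t) * t = a) //.
by rewrite -[RHS]conjg1 -(transposition_sq Tt) conjgM !conjgE !mulgA.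
Qed.

Lemma sq_comm E s : T_word E -> s * sq E = sq E * s.
Proof.
elim: E => [|t E IHE] /=; first by rewrite /sq big_nil mul1g mulg1.
by case/andP=> Tt TE; rewrite sq_cons mulgA x_sq_comm // -mulgA IHE // mulgA.
Qed.

Lemma sq_perm E F : T_word E -> perm_eq E F -> sq E = sq F.
Proof.
move=> TE EF; have TF : T_word F by rewrite -(perm_all _ EF).
move: TF; pose P F := T_word F -> sq E = sq F.
apply: (@catCA_perm_ind _ P) EF _ => // u v w.
rewrite /P !all_cat => IH /and3P[Tv Tu Tw]; rewrite IH ?Tu ?Tv //.
by rewrite !sq_cat !mulgA (sq_comm (sq u) Tv).
Qed.

Lemma x_sq_conj1 t a : t \in transpositions d ->
  x_ a * x2 t = x_ a * x2 (t ^ a).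
Proof.
move=> Tt; have xta : x_ a * x_ (t ^ a) = x_ t * x_ a.
  by rewrite x_conjL conjgE !mulgA mulgV mul1g mulgK.
by rewrite x_sq_comm // !x2E [RHS]mulgA xta -[RHS]mulgA xta mulgA.
Qed.

(* The square of a transposition is central, and carrying it through a letter a
   conjugates it by a. *)
Lemma x_sq_conj s t g : t \in transpositions d -> g \in letter_group s ->
  s * x2 t = s * x2 (t ^ g).
Proof.
elim/wordW: s => w; rewrite letter_group_word.
pose G := [set g : 'S_d | `[< forall t, t \in transpositions d ->
  word w * x2 t = word w * x2 (t ^ g) >]].
have gG : group_set G.
  apply/group_setP; split=> [|b c]; rewrite !inE.
    by apply/asboolP=> r _; rewrite conjg1.
  move=> /asboolP Gb /asboolP Gc; apply/asboolP=> r Tr.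
  by rewrite Gb // Gc ?transpositionJ // conjgM.
suff /subsetP sG : gen w \subset Group gG.
  by move=> Tt /sG; rewrite inE => /asboolP; apply.
rewrite gen_subG; apply/subsetP=> a; rewrite !inE => aw; apply/asboolP=> r Tr.
case/splitPr: aw => u v; rewrite -cat1s -!wordM -!mulgA; congr (_ * _).
rewrite !(x_sq_comm (word v)) ?transpositionJ // !mulgA.
by rewrite -/(x_ a) x_sq_conj1.
Qed.

Lemma letter_group_sq u E : letter_group (word u * sq E) = gen (u ++ E).
Proof.
rewrite sqE wordM letter_group_word; apply: eq_gen_mem => a.
by rewrite !mem_cat mem_doubles.
Qed.

(** A new front letter [t] either joins two cycles of the product, and the word stays minimal, or
    has both points in one cycle. In the latter case [pull_tperm] brings a second [t] to the front
    of [w'], and the pair splits off as a square. *)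
Lemma sq_extract w : T_word w -> exists w' E,
  [/\ T_word w', T_word E, word w = word w' * sq E
    & size w' = l_t (\prod_(a <- w') a)].
Proof.
elim: w => [_|t w IHw /= /andP[Tt /IHw[w' [E [Tw' TE wE szw']]]]].
  by exists [::], [::]; split; rewrite ?big_nil ?l_t1 // /sq big_nil mulg1.
rewrite word_cons wE; have /transpositionP[p [q pq tE]] := Tt.
have [qa|qa] := boolP (q \in porbit (\prod_(a <- w') a) p); last first.
  exists (t :: w'), E; split; rewrite ?word_cons ?mulgA //= ?Tt //.
  by rewrite big_cons tE l_t_join // szw'.
have cw' : conn w' p q.
  case/porbitP: qa => i ->; exists ((\prod_(a <- w') a) ^+ i) => //.
  by rewrite groupX // prod_mem_gen.
have [v Tv w'v] := pull_tperm Tw' pq cw'; rewrite -tE in w'v.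
have szv : size w' = (size v).+1.
  by rewrite (T_word_size Tw' _ w'v) //= Tt.
exists v, (t :: E); split; rewrite //= ?Tt //.
  rewrite (proj2 (wordP _ _) w'v) word_cons sq_cons !mulgA -x2E.
  by rewrite -x_sq_comm.
apply: succn_inj; rewrite -szv szw' (l_t_split pq qa) -tE.
by rewrite (sigma_cong_prod w'v) big_cons mulgA transposition_sq // mul1g.
Qed.

(** * Graphs of transpositions and generation of the symmetric group *)

Lemma conn_tperm w x y : T_word w -> conn w x y -> tperm x y \in gen w.
Proof.
have [<- _ _|xy Tw cxy] := eqVneq x y; first by rewrite tperm1 group1.
have [w' Tw' /sigma_cong_gen->] := pull_tperm Tw xy cxy.
by rewrite mem_gen_word // mem_head.
Qed.

Lemma tperm_conn w x y : tperm x y \in gen w -> conn w x y.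
Proof. by exists (tperm x y); rewrite ?tpermL. Qed.

Lemma gen_setT w : T_word w -> (forall x y, conn w x y) -> gen w = [set: 'S_d].
Proof.
move=> Tw cw; apply/setP=> a; rewrite inE.
have [v [Tv <- _]] := min_factorization a.
rewrite big_seq group_prod // => b /(allP Tv)/transpositionP[p [q _ ->]].
exact: conn_tperm.
Qed.

Lemma setT_conn w x y : gen w = [set: 'S_d] -> conn w x y.
Proof. by move=> gw; apply: tperm_conn; rewrite gw inE. Qed.

Lemma tperm_conj_ex p q x y : p != q -> x != y ->
  exists g : 'S_d, tperm p q ^ g = tperm x y.
Proof.
(* The first factor carries [p] to [x]; the second carries the image of [q] to [y] and fixes [x]. *)
move=> pq xy; exists (tperm p x * tperm (tperm p x q) y).
rewrite conjgM !tpermJ !tpermL tpermD //; last by rewrite eq_sym.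
by rewrite -[x in _ != x](tpermL p x) (inj_eq perm_inj) eq_sym.
Qed.

(** If no edge has its ends connected by the later ones, the graph is a forest and each letter joins
    two cycles of the product, so [l_t] counts the letters. *)
Lemma redundant_or_minimal w : T_word w ->
  (exists u p q v, [/\ w = u ++ tperm p q :: v, p != q & conn v p q]) \/
  size w = l_t (\prod_(a <- w) a).
Proof.
elim: w => [_|t w IHw /= /andP[/transpositionP[p [q pq ->]] /IHw]].
  by right; rewrite big_nil l_t1.
move=> [[u [p' [q' [v [-> pq' cv]]]]]|szw].
  by left; exists (tperm p q :: u), p', q', v.
have [cw|ncw] := pselect (conn w p q); first by left; exists [::], p, q, w.
right; rewrite big_cons l_t_join ?szw //; apply/negP=> /porbitP[i qE].
apply: ncw; exists ((\prod_(a <- w) a) ^+ i) => //.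
by rewrite groupX // prod_mem_gen.
Qed.

(** The product has d minus [l_t] orbits, hence at most one, and its powers already act
    transitively. *)
Lemma minimal_conn w x y : d.-1 <= size w ->
  size w = l_t (\prod_(a <- w) a) -> conn w x y.
Proof.
move=> dw szw; set a := \prod_(a <- w) a in szw.
have po1 : #|porbits a| <= 1.
  by have := l_t_porbits a; rewrite -szw; have := ltn_ord x; lia.
have: porbit a x = porbit a y.
  have /card_le1_eqP H := po1; apply: H; exact: imset_f.
move/eqP; rewrite eq_sym eq_porbit_mem => /porbitP[i ->].
by exists (a ^+ i); rewrite ?groupX ?prod_mem_gen.
Qed.

(* An edge closing a cycle in the graph E is not needed to generate 'S_d, so it
   can be conjugated into an edge joining two components of E. *)
Lemma sq_generating Z E : T_word E -> d.-1 <= size E ->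
  gen (Z ++ E) = [set: 'S_d] ->
  exists E', [/\ T_word E', size E' = size E, gen E' = [set: 'S_d]
    & word Z * sq E = word Z * sq E'].
Proof.
(* Induction on the number of permutations that [gen E] misses. *)
have [n] := ubnP (#|[set: 'S_d]| - #|gen E|).
elim: n E => // n IHn E leEn TE szE gZE.
have [gE|ngE] := eqVneq (gen E) [set: 'S_d]; first by exists E.
have [cE|/existsNP[x /existsNP[y ncxy]]] := pselect (forall x y, conn E x y).
  by rewrite gen_setT ?eqxx in ngE.
have xy : x != y by apply: contra_notN ncxy => /eqP->; exact: conn_refl.
(* A minimal word of this length would connect [x] and [y], so some edge [tperm p q] is
   redundant. *)
have [|szl] := redundant_or_minimal TE; last first.
  by case: ncxy; exact: minimal_conn.
case=> u [p [q [v [EE pq cv]]]]; have [g gE] := tperm_conj_ex pq xy.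
have TEuv : T_word (tperm p q :: u ++ v).
  by move: TE; rewrite EE /= !all_cat /= => /and3P[-> -> ->].
have Tpq := tperm_transposition pq.
have Tuv : T_word (u ++ v) by case/andP: TEuv.
have Tv : T_word v by move: Tuv; rewrite all_cat => /andP[].
have Epm : perm_eq E (tperm p q :: u ++ v).
  by rewrite EE perm_catC /= perm_cons perm_catC.
have suv : gen E \subset gen (u ++ v).
  apply: gen_sub => a; rewrite (perm_mem Epm) inE => /predU1P[->|]; last first.
    exact: mem_gen_word.
  apply: subsetP (conn_tperm Tv cv); apply: sub_gen_word => b bv.
  by rewrite mem_cat bv orbT.
(* Dropping the redundant edge keeps the generated group whole, so any conjugator [g] is
   available. *)
have gZuv : g \in letter_group (word Z * sq (u ++ v)).
  rewrite letter_group_sq; have: g \in gen (Z ++ E) by rewrite gZE inE.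
  apply: subsetP; apply: gen_sub => a; rewrite mem_cat => /orP[aZ|aE].
    by rewrite mem_gen_word // mem_cat aZ.
  have: a \in gen (u ++ v) by apply: (subsetP suv); exact: mem_gen_word.
  by apply: subsetP; apply: sub_gen_word => b bv; rewrite mem_cat bv orbT.
have Txy := tperm_transposition xy.
have sqE' : word Z * sq E = word Z * sq (tperm x y :: u ++ v).
  rewrite (sq_perm TE Epm) !sq_cons -!x_sq_comm // !mulgA.
  by rewrite (x_sq_conj _ gZuv) ?gE.
have sE' : gen E \proper gen (tperm x y :: u ++ v).
  apply/properP; split.
    apply: subset_trans suv _; apply: sub_gen_word => b bv.
    by rewrite inE bv orbT.
  exists (tperm x y); first by rewrite mem_gen_word // mem_head.
  by apply/negP=> /tperm_conn.
have szE' : size (tperm x y :: u ++ v) = size E by rewrite (perm_size Epm).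
have [||||E' [TE' szEE' gE' EE']] := IHn (tperm x y :: u ++ v).
- have ltEE' := proper_card sE'; rewrite -ltnS; apply: leq_trans leEn.
  rewrite ltnS; apply: ltn_sub2l => //; apply: leq_trans ltEE' _.
  exact/subset_leq_card/subsetT.
- by rewrite /= Txy.
- by rewrite szE'.
- apply/eqP; rewrite eqEsubset subsetT -gZE; apply: gen_sub => a.
  rewrite mem_cat => /orP[aZ|aE].
    by rewrite mem_gen_word // mem_cat aZ.
  have := subsetP (proper_sub sE') _ (mem_gen_word aE); apply: subsetP.
  by apply: sub_gen_word => b bv; rewrite mem_cat bv orbT.
by exists E'; rewrite sqE' EE' szEE' szE'.
Qed.

(** An exchange property as for spanning trees. The edge to be traded is the one whose addition,
    reading [E] from its end, first connects [x] and [y]; the edges after it contain paths from [x]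
    and [y] to its two ends. *)
Lemma sq_exchange E F x y : T_word E -> T_word F -> x != y ->
  conn (E ++ F) x y -> ~ conn F x y ->
  exists E', [/\ T_word E', size E = (size E').+1,
    sq (E ++ F) = sq (E' ++ tperm x y :: F)
    & gen (E' ++ tperm x y :: F) = gen (E ++ F)].
Proof.
move=> + TF xy + ncF; elim: E => [_ /ncF //|e E IHE].
move=> /= /andP[Te TE] cEF.
have [/IHE|ncEF] := pselect (conn (E ++ F) x y).
  case=> // E' [TE' szE sqE' gE']; exists (e :: E'); split.
  - by rewrite /= Te.
  - by rewrite /= szE.
  - by rewrite /= !sq_cons sqE'.
  - have genC u v : gen u = gen v -> gen (e :: u) = gen (e :: v).
      move=> uv; have catE w : [set b in e :: w] = [set e] :|: [set b in w].
        by apply/setP=> b; rewrite !inE.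
      by rewrite !catE -!/(joing _ _) -joing_idr uv joing_idr.
    exact: genC.
have TEF : T_word (E ++ F) by rewrite all_cat TE.
have [p [q [pq eE cxp cqy]]] : exists p q,
    [/\ p != q, e = tperm p q, conn (E ++ F) x p & conn (E ++ F) q y].
  case/transpositionP: Te cEF => p [q pq ->] /conn_cons[//|[c1 c2]|[c1 c2]].
    by exists p, q.
  by exists q, p; rewrite eq_sym tpermC.
have xq : x != q by apply: contra_notN ncEF => /eqP->.
(* The factors move [p] to [x] and [q] to [y], and lie in the group of the edges after [e] because
   those edges connect these pairs. *)
pose g := tperm x p * tperm q y.
have gEF : g \in gen (E ++ F) by rewrite groupM ?conn_tperm.
have eg : e ^ g = tperm x y.
  by rewrite eE conjgM !tpermJ tpermR (tpermD xq pq) tpermL tpermD // eq_sym.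
have Txy := tperm_transposition xy.
have perm1 : perm_eq (E ++ tperm x y :: F) (tperm x y :: E ++ F).
  by rewrite perm_catC /= perm_cons perm_catC.
have T1 : T_word (E ++ tperm x y :: F) by rewrite all_cat /= TE Txy.
exists E; split=> //.
  rewrite (sq_perm T1 perm1) /= !sq_cons -!x_sq_comm //.
  rewrite -[sq _]mul1g -word1 -eg; apply: x_sq_conj => //.
  by rewrite letter_group_sq.
rewrite (eq_gen_mem (perm_mem perm1)) /= -eg.
have sub a : gen (E ++ F) \subset gen (a :: E ++ F).
  by apply: sub_gen_word => b bw; rewrite inE bw orbT.
apply/eqP; rewrite eqEsubset; apply/andP; split; apply: gen_sub => a;
  rewrite inE => /predU1P[->|aw]; try by rewrite mem_gen_word // inE aw orbT.
  by rewrite groupJ ?(subsetP (sub _) _ gEF) // mem_gen_word ?mem_head.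
rewrite -[X in X \in _](conjgK g e).
by rewrite groupJ ?groupV ?(subsetP (sub _) _ gEF) // mem_gen_word ?mem_head.
Qed.

(** * Reduction to the Hurwitz element *)

Definition path_edge i : 'S_d := interval_cycle d i 2.

(** Listed backwards so that lengthening the path adds its new edge at the head, as [sq_exchange]
    does. *)
Definition path_edges j : seq 'S_d := [seq path_edge i | i <- rev (iota 0 j)].

Lemma path_edgesS j : path_edges j.+1 = path_edge j :: path_edges j.
Proof. by rewrite /path_edges -addn1 iotaD rev_cat. Qed.

Lemma path_edge_transposition i : i < d.-1 -> path_edge i \in transpositions d.
Proof.
move=> id; have id0 : i < d by lia.
have id1 : i.+1 < d by lia.
rewrite /path_edge (interval_cycle2 id0 id1) tperm_transposition //.
by rewrite -val_eqE /=; lia.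
Qed.

Lemma path_edges_transpositions j : j <= d.-1 -> T_word (path_edges j).
Proof.
elim: j => // j IHj jd; rewrite path_edgesS /= path_edge_transposition //.
by rewrite IHj //; lia.
Qed.

Lemma path_edges_fix j a (z : 'I_d) : j <= d.-1 -> a \in gen (path_edges j) ->
  j < z -> a z = z.
Proof.
move=> jd + jz; suff /subsetP sG : gen (path_edges j) \subset 'C[z | 'P].
  by move/sG/astab1P.
rewrite gen_subG; apply/subsetP=> b; rewrite inE => /mapP[i].
rewrite mem_rev mem_iota => ij ->; apply/astab1P; apply: val_inj.
rewrite /= interval_cycleE; last by lia.
by case: ifP => //; lia.
Qed.

(** The path built so far fixes every point beyond [j], so it does not connect [j] with [j.+1], and
    [sq_exchange] trades a remaining edge for the next path edge. *)
Lemma sq_path E j : T_word E -> gen E = [set: 'S_d] -> j <= d.-1 ->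
  exists R, [/\ T_word R, size R + j = size E,
    sq E = sq (R ++ path_edges j) & gen (R ++ path_edges j) = [set: 'S_d]].
Proof.
move=> TE gE; elim: j => [_|j IHj jd].
  by exists E; rewrite cats0 addn0.
have [|R [TR szR sqR gR]] := IHj; first by lia.
have jd0 : j < d by lia.
have jd1 : j.+1 < d by lia.
pose x := Ordinal jd0; pose y := Ordinal jd1.
have xy : x != y by rewrite -val_eqE /=; lia.
have cxy : conn (R ++ path_edges j) x y by exact: setT_conn.
have ncxy : ~ conn (path_edges j) x y.
  move=> /conn_sym[a ga ayx]; move: xy; rewrite -ayx.
  by rewrite (path_edges_fix _ ga) ?eqxx //=; lia.
have Tj : T_word (path_edges j) by apply: path_edges_transpositions; lia.
have [R' [TR' szR' sqR' gR']] := sq_exchange TR Tj xy cxy ncxy.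
exists R'; rewrite path_edgesS /path_edge (interval_cycle2 jd0 jd1) -/x -/y.
by split; rewrite ?sqR ?gR' ?gR // -szR szR' addSnnS.
Qed.

Lemma path_edges_gen : gen (path_edges d.-1) = [set: 'S_d].
Proof.
apply: gen_setT => [|x y]; first exact: path_edges_transpositions.
have c0 j (z z0 : 'I_d) : z0 = 0%N :> nat -> z <= j -> j <= d.-1 ->
    conn (path_edges j) z z0.
  move=> z00; elim: j z => [|j IHj] z zj jd.
    by rewrite (_ : z = z0); [exact: conn_refl|apply: val_inj => /=; lia].
  have [zj'|zj'] := leqP z j.
    by rewrite path_edgesS; apply/conn_consW/IHj => //; lia.
  have jd0 : j < d by lia.
  have jd1 : j.+1 < d by lia.
  have cj : conn (path_edges j.+1) (Ordinal jd0) z0.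
    by rewrite path_edgesS; apply/conn_consW/IHj => //=; lia.
  apply: conn_trans cj; apply: conn_sym.
  have -> : z = Ordinal jd1 by apply: val_inj => /=; lia.
  apply: tperm_conn; rewrite -(interval_cycle2 jd0 jd1) path_edgesS.
  by rewrite mem_gen_word ?mem_head.
have d0 : 0 < d by have := ltn_ord x; lia.
have cz (z : 'I_d) : conn (path_edges d.-1) z (Ordinal d0).
  by apply: c0 => //; have := ltn_ord z; lia.
exact: conn_trans (cz x) (conn_sym (cz y)).
Qed.

(** All transpositions are conjugate, and [F] alone supplies every conjugator. *)
Lemma sq_concentrate R F t : T_word R -> T_word F -> t \in transpositions d ->
  gen F = [set: 'S_d] -> sq (R ++ F) = sq (nseq (size R) t ++ F).
Proof.
move=> TR TF Tt gF; elim: R TR => //= e R IHR /andP[Te TR].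
rewrite !sq_cons -IHR // -!x_sq_comm //.
case/transpositionP: Te Tt => p [q pq ->] /transpositionP[x [y xy ->]].
have [g <-] := tperm_conj_ex pq xy.
rewrite -[sq _]mul1g -word1; apply: x_sq_conj; first exact: tperm_transposition.
have: g \in gen F by rewrite gF inE.
rewrite letter_group_sq; apply: subsetP; apply: sub_gen_word => b bF.
by rewrite /= mem_cat bF orbT.
Qed.

Lemma sq_hurwitz E : 2 <= d -> T_word E -> gen E = [set: 'S_d] ->
  exists2 n, size E = (n + d.-1)%N & sq E = hurwitz_element d n.
Proof.
move=> hd TE gE; have [R [TR szR sqR _]] := sq_path TE gE (leqnn _).
exists (size R) => //.
have T0 : path_edge 0 \in transpositions d.
  by apply: path_edge_transposition; lia.
have Tp := path_edges_transpositions (leqnn d.-1).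
rewrite sqR (sq_concentrate TR Tp T0 path_edges_gen).
pose v := [seq path_edge i | i <- iota 0 d.-1].
have pv : perm_eq (path_edges d.-1) v by rewrite perm_map // perm_rev.
rewrite sq_cat (sq_perm Tp pv) /v.
have x2X t : x2 t = x_ t ^+ 2 by rewrite x2E expgS expg1.
have sqn n t : sq (nseq n t) = x_ t ^+ (2 * n).
  rewrite /sq big_nseq; elim: n => [|n IHn]; first by rewrite muln0.
  by rewrite iterS IHn mulnS [RHS](expgD _ 2) x2X.
(* The first path edge is split off: its square joins the [size R] concentrated ones, which gives
   the exponent [2 * (size R).+1]. *)
rewrite (_ : d.-1 = d.-2.+1); last by lia.
rewrite [iota _ _]/= [map _ _]/= sq_cons mulgA.
rewrite sqn x2X -(expgD _ _ 2) /hurwitz_element mulnS addnC; congr (_ * _).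
rewrite /sq big_map /index_iota (_ : d.-1 - 1 = d.-2)%N; last by lia.
by apply: eq_bigr => i _; rewrite x2X.
Qed.

(** * Lengths and the normal form of long words in transpositions *)

Lemma T_double E : T_word E -> T_word (doubles E).
Proof. by rewrite (eq_all_r (@mem_doubles E)). Qed.

Lemma size_double E : size (doubles E) = (2 * size E)%N.
Proof. by elim: E => //= t E ->; lia. Qed.

Lemma size_wordM_sq w w' E : T_word w -> T_word w' -> T_word E ->
  word w = word w' * sq E -> size w = (size w' + 2 * size E)%N.
Proof.
rewrite sqE wordM => Tw Tw' TE /wordP ww'.
rewrite (T_word_size Tw _ ww') ?size_cat ?size_double //.
by rewrite all_cat Tw' T_double.
Qed.

Lemma alpha_sq E : T_word E -> alpha (sq E) = 1.
Proof.
rewrite sqE alpha_word; elim: E => [|t E IHE] /=; first by rewrite big_nil.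
by case/andP=> Tt TE; rewrite !big_cons IHE // mulg1 transposition_sq.
Qed.

Lemma l_t_le a : l_t a <= d.-1.
Proof.
have := l_t_porbits a; suff: 0 < #|porbits a| \/ d = 0%N by lia.
case: (posnP d) => d0; [by right|left].
by apply/card_gt0P; exists (porbit a (Ordinal d0)); exact: imset_f.
Qed.

(** [Z] stays in front because [w] alone may fail to generate ['S_d]; its letters help to conjugate
    the squares until these generate by themselves. *)
Lemma generating_squares Z w : T_word w -> 3 * (d - 1) <= size w ->
  gen (Z ++ w) = [set: 'S_d] -> exists w' E,
  [/\ T_word w' /\ T_word E, gen E = [set: 'S_d],
      size w' = l_t (\prod_(a <- w') a), size w = (size w' + 2 * size E)%N
    & word Z * word w = word Z * (word w' * sq E)].
Proof.
move=> Tw szw gZw; have [w' [E [Tw' TE wE szw']]] := sq_extract Tw.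
have szE := size_wordM_sq Tw Tw' TE wE.
have gZE : gen ((Z ++ w') ++ E) = [set: 'S_d].
  by rewrite -letter_group_sq -wordM -mulgA -wE wordM letter_group_word.
(* At most d - 1 letters go to [w'], so at least 2(d - 1) remain, that is d - 1 squares. *)
have [|E' [TE' szE' gE' EE']] := sq_generating TE _ gZE.
  by have := l_t_le (\prod_(a <- w') a); lia.
exists w', E'; split=> //; first by rewrite szE'.
by rewrite wE !mulgA wordM.
Qed.

(** Both sides are minimal factorizations of the same permutation, and these are unique in
    [Sigma d]. *)
Lemma T_word_regen w : T_word w -> size w = l_t (\prod_(a <- w) a) ->
  word w = regen (x_ (\prod_(a <- w) a)).
Proof.
move=> Tw szw; have [STf _ fa fl _] := regenP d.
set b := \prod_(a <- w) a in szw *.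
have /in_STP[v Tv vE] := STf (x_ b); move: (fa b) (fl b).
rewrite vE alpha_word ln_word T_word_count // => vb szv.
by apply/wordP/min_factorization_uniq; rewrite ?vb // szv.
Qed.

Lemma generating_T_word_normal_form w : 2 <= d -> T_word w ->
  3 * (d - 1) <= size w -> gen w = [set: 'S_d] ->
  exists2 n, size w = (l_t (\prod_(a <- w) a) + 2 * (n + d.-1))%N &
    word w = regen (x_ (\prod_(a <- w) a)) * hurwitz_element d n.
Proof.
move=> hd Tw szw gw.
have [w' [E [[Tw' TE] gE szw' szE]]] :=
  generating_squares (Z := [::]) Tw szw gw.
rewrite !mul1g => wE; have [n nE sqE'] := sq_hurwitz hd TE gE.
have aw : \prod_(a <- w) a = \prod_(a <- w') a.
  by rewrite -!alpha_word wE alphaM alpha_sq // mulg1.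
by exists n; rewrite aw -?szw' -?nE // wE sqE' T_word_regen.
Qed.

(** * Conjugating single letters *)

Lemma gen_nil : gen ([::] : seq 'S_d) = 1.
Proof. by rewrite (_ : [set _ in _] = set0) ?gen0. Qed.

(** One copy of [t] from a square is spent on turning [a] into [a ^ t]; the other copy keeps the
    edge [t] in the graph, so the word still generates. *)
Lemma conjugate_letter1 a t w : t \in transpositions d -> T_word w ->
  3 * (d - 1) <= size w -> gen w = [set: 'S_d] -> exists w',
  [/\ T_word w', size w' = size w, gen w' = [set: 'S_d]
    & x_ a * word w = x_ (a ^ t) * word w'].
Proof.
move=> Tt Tw szw gw; have /transpositionP[x [y xy tE]] := Tt.
have [w' [E [[Tw' TE] gE szw' szE]]] :=
  generating_squares (Z := [::]) Tw szw gw.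
rewrite !mul1g => wE.
(* With nothing to preserve in [F], the exchange makes [t] itself one of the edges. *)
have [||E' [TE' szE' sqE' gE']] := sq_exchange (F := [::]) TE isT xy.
- by rewrite cats0; exact: setT_conn.
- by move=> [b]; rewrite gen_nil inE => /eqP-> /eqP; rewrite perm1 (negPf xy).
rewrite !cats0 -tE in sqE' gE'; rewrite gE in gE'.
exists [:: t ^ (a ^ t), t & w' ++ doubles E']; split.
- by rewrite /= transpositionJ ?Tt // all_cat Tw' T_double.
- by rewrite /= size_cat size_double; lia.
- apply/eqP; rewrite eqEsubset subsetT -gE'; apply: sub_gen_word => b.
  rewrite mem_cat !inE mem_cat => /orP[bE|->]; last by rewrite orbT.
  by rewrite mem_doubles bE !orbT.
have xat : x_ a * x_ t = x_ (a ^ t) * x_ (t ^ (a ^ t)).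
  by rewrite x_conjR x_conjR -!mulgA -!conjgE.
rewrite !word_cons -wordM -sqE wE sqE' sq_cat (sq_cons t) sq_nil mulg1.
by rewrite [_ * (sq E' * _)]mulgA x_sq_comm // x2E !mulgA xat.
Qed.

(** The conjugator is a product of transpositions, applied one at a time. *)
Lemma conjugate_letter a g w : T_word w ->
  3 * (d - 1) <= size w -> gen w = [set: 'S_d] -> exists w',
  [/\ T_word w', size w' = size w, gen w' = [set: 'S_d]
    & x_ a * word w = x_ (a ^ g) * word w'].
Proof.
have [v [+ <- _]] := min_factorization g.
elim: v a w => [|t v IHv] a w; first by rewrite big_nil conjg1; exists w.
move=> /= /andP[Tt Tv] Tw szw gw.
have [w1 [Tw1 szw1 gw1 aw1]] := conjugate_letter1 a Tt Tw szw gw.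
have [|w2 [Tw2 szw2 gw2 aw2]] := IHv (a ^ t) w1 Tv Tw1 _ gw1.
  by rewrite szw1.
by exists w2; rewrite szw2 szw1 aw1 aw2 big_cons conjgM.
Qed.

Lemma gen_conj w g : gen w = [set: 'S_d] ->
  gen [seq a ^ g | a <- w] = [set: 'S_d].
Proof.
move=> gw; have -> : [set b in [seq a ^ g | a <- w]] = [set b in w] :^ g.
  apply/setP=> b; rewrite inE; apply/mapP/imsetP=> -[a aw ->];
    by exists a => //; move: aw; rewrite inE.
by rewrite genJ gw; apply/normP; rewrite (subsetP (normG _)) ?inE.
Qed.

Lemma T_word_conj w g : T_word w -> T_word [seq a ^ g | a <- w].
Proof.
by move=> /allP Tw; apply/allP=> _ /mapP[c cm ->]; apply/transpositionJ/Tw.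
Qed.

Lemma conjugate_letters (f : 'S_d -> 'S_d) Z w :
  (forall a, exists g, f a = a ^ g) -> T_word w ->
  3 * (d - 1) <= size w -> gen w = [set: 'S_d] -> exists w',
  [/\ T_word w', size w' = size w, gen w' = [set: 'S_d]
    & word Z * word w = word (map f Z) * word w'].
Proof.
move=> fJ; elim: Z w => [|a Z IHZ] w Tw szw gw; first by exists w.
(* [u] is [w] carried leftwards across [Z], next to [a]; after [a] is conjugated, the new word is
   carried back across [Z]. *)
pose z := \prod_(b <- Z) b; pose u := [seq b ^ z^-1 | b <- w].
have moveZ v : word v * word Z = word Z * word [seq b ^ z | b <- v].
  by rewrite !wordM; apply/wordP/sigma_cong_cat_conj.
have wu : [seq b ^ z | b <- u] = w.
  by rewrite -map_comp -[RHS]map_id; apply: eq_map => b /=; rewrite conjgKV.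
have [g fg] := fJ a.
have [||u1 [Tu1 szu1 gu1 au1]] := conjugate_letter a g (T_word_conj z^-1 Tw).
- by rewrite size_map.
- exact: gen_conj.
have [|||w' [Tw' szw' gw' Zw']] := IHZ [seq b ^ z | b <- u1].
- exact: T_word_conj.
- by rewrite size_map szu1 size_map.
- exact: gen_conj.
exists w'; split=> //; first by rewrite szw' size_map szu1 size_map.
rewrite /= !word_cons -!mulgA -Zw' -moveZ !mulgA fg -au1 -mulgA.
by rewrite -/u -[_ * word u * _]mulgA moveZ wu.
Qed.

End Words.

(** * Cycle type and conjugacy *)

Section CanonicalRepresentative.
Variable d : nat.
Implicit Types (a g : 'S_d) (c l : seq 'I_d) (cs : seq (seq 'I_d)).
Implicit Types (x y : 'I_d) (o : {set 'I_d}) (ks : seq nat).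

Lemma cycle_permE c x : uniq c -> cycle_perm c x = next c x.
Proof. by move=> Uc; rewrite permE undup_id. Qed.

Lemma next_out c x : x \notin c -> next c x = x.
Proof. by rewrite next_nth => /negPf->. Qed.

Lemma cycle_permJ c g : uniq c -> cycle_perm c ^ g = cycle_perm (map g c).
Proof.
move=> Uc; apply/permP=> x; rewrite -(permKV g x) permJ !cycle_permE //.
  by rewrite next_map //; exact: perm_inj.
by rewrite map_inj_uniq //; exact: perm_inj.
Qed.

Lemma uniq_flatten_mem cs c : uniq (flatten cs) -> c \in cs -> uniq c.
Proof.
elim: cs => //= c' cs IHcs; rewrite cat_uniq inE => /and3P[Uc' _ Ucs].
by case/predU1P=> [->|/IHcs->].
Qed.

Lemma prod_cycle_perm_out cs x : uniq (flatten cs) -> x \notin flatten cs ->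
  (\prod_(c <- cs) cycle_perm c) x = x.
Proof.
elim: cs => [|c cs IHcs] /=; first by rewrite big_nil perm1.
rewrite cat_uniq mem_cat negb_or => /and3P[Uc _ Ucs] /andP[xc xcs].
by rewrite big_cons permM cycle_permE // next_out // IHcs.
Qed.

Lemma prod_cycle_perm_in cs c x : uniq (flatten cs) -> c \in cs -> x \in c ->
  (\prod_(c <- cs) cycle_perm c) x = next c x.
Proof.
elim: cs => //= c' cs IHcs; rewrite cat_uniq inE => /and3P[Uc' /hasPn Dc Ucs].
rewrite big_cons permM cycle_permE // => /predU1P[-> xc'|ccs xc].
  rewrite prod_cycle_perm_out //; apply/negP=> /Dc /=.
  by rewrite mem_next xc'.
rewrite next_out; first exact: IHcs.
by apply: Dc; apply/flattenP; exists c.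
Qed.

Lemma perm_extending l l' : uniq l -> uniq l' -> size l = size l' ->
  exists g, map g l = l'.
Proof.
move=> Ul Ul' szl.
(* [C l] lists all points starting with [l]; matching the positions in [C l] and [C l'] gives the
   permutation. *)
pose C l := l ++ [seq x <- enum 'I_d | x \notin l].
have UC k : uniq k -> uniq (C k).
  move=> Uk; rewrite cat_uniq Uk filter_uniq ?enum_uniq // andbT.
  by apply/hasPn=> x; rewrite mem_filter => /andP[].
have memC k x : x \in C k.
  by rewrite mem_cat mem_filter mem_enum andbT orbN.
have szC k : uniq k -> size (C k) = d.
  move=> /UC/card_uniqP <-; rewrite -[RHS]card_ord.
  by apply: eq_card => x; rewrite memC.
have idx x : index x (C l) < size (C l').
  by rewrite (_ : size (C l') = size (C l)) ?index_mem ?memC // !szC.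
pose f x := nth x (C l') (index x (C l)).
have f_inj : injective f.
  move=> x y; rewrite /f (set_nth_default y) // => /eqP.
  rewrite nth_uniq ?UC // => /eqP xy.
  by rewrite -(nth_index x (memC l x)) xy nth_index.
exists (perm f_inj); case: l' => [|x0 l'] in szl Ul' f f_inj idx *.
  by rewrite (size0nil szl).
apply: (@eq_from_nth _ x0); first by rewrite size_map.
move=> i; rewrite size_map => il; rewrite (nth_map x0) // permE /f.
rewrite (set_nth_default x0) // index_cat mem_nth // index_uniq //.
by rewrite nth_cat -szl il.
Qed.

(** A permutation matching the concatenated lists of points matches the cycles too, since the block
    lengths agree. *)
Lemma prod_cycle_perm_conj cs cs' : uniq (flatten cs) -> uniq (flatten cs') ->
  shape cs = shape cs' ->
  exists g, (\prod_(c <- cs) cycle_perm c) ^ g = \prod_(c <- cs') cycle_perm c.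
Proof.
move=> U U' sh; have [|g gE] := perm_extending U U'.
  by rewrite !size_flatten sh.
exists g; have <- : map (map g) cs = cs'.
  apply: eq_from_flatten_shape; first by rewrite -map_flatten.
  by rewrite -sh /shape -map_comp; apply: eq_map => c /=; rewrite size_map.
rewrite big_map conjg_prod !big_seq; apply: eq_bigr => c ccs.
by rewrite cycle_permJ // (uniq_flatten_mem U).
Qed.

(** The list inside [interval_cycle], so that [cycle_perm (interval b k)] is convertible to it. *)
Definition interval (b k : nat) : seq 'I_d :=
  [seq i : 'I_d <- enum 'I_d | b <= i < b + k].

Lemma val_interval b k : b + k <= d -> map val (interval b k) = iota b k.
Proof.
move=> bkd; have -> : iota b k = [seq x <- iota 0 d | b <= x < b + k].
  apply: (@irr_sorted_eq _ ltn); rewrite ?iota_ltn_sorted //.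
  - exact: ltn_trans.
  - exact: ltnn.
  - by apply: sorted_filter (iota_ltn_sorted _ _); exact: ltn_trans.
  - by move=> x; rewrite mem_filter !mem_iota; lia.
by rewrite -val_enum_ord filter_map.
Qed.

(** The blocks are consecutive, which makes the canonical cycles disjoint. *)
Lemma flatten_iota ks b :
  flatten [seq iota (b + sumn (take i ks)) (nth 0%N ks i)
          | i <- iota 0 (size ks)] = iota b (sumn ks).
Proof.
elim: ks b => [|k ks IHks] b //=.
rewrite addn0 iotaD -IHks (iotaDl 1 0) -map_comp; congr (_ ++ flatten _).
by apply: eq_map => i /=; rewrite addnA.
Qed.

Lemma canonical_of_typeE ks : sumn ks <= d -> exists cs,
  [/\ canonical_of_type d ks = \prod_(c <- cs) cycle_perm c,
      uniq (flatten cs) & shape cs = ks].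
Proof.
move=> ksd; pose I i := interval (sumn (take i ks)) (nth 0%N ks i).
have leI i : i \in iota 0 (size ks) -> sumn (take i ks) + nth 0%N ks i <= d.
  rewrite mem_iota /= add0n => iks; apply: leq_trans ksd.
  rewrite -{3}(cat_take_drop i ks) sumn_cat (drop_nth 0%N) //=.
  by rewrite addnA leq_addr.
exists (map I (iota 0 (size ks))); split.
- rewrite big_map /canonical_of_type.
  rewrite -(big_mkord xpredT (fun i => cycle_perm (I i))).
  by rewrite /index_iota subn0.
- rewrite -(map_inj_uniq val_inj) map_flatten -map_comp.
  rewrite (_ : map _ _ = [seq iota (0 + sumn (take i ks)) (nth 0%N ks i)
          | i <- iota 0 (size ks)]); first by rewrite flatten_iota iota_uniq.
  by apply/eq_in_map => i /leI le_i /=; rewrite val_interval.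
- rewrite /shape -map_comp -[RHS](mkseq_nth 0%N).
  apply/eq_in_map => i /leI le_i.
  by rewrite /= -(size_map val) val_interval // size_iota.
Qed.

(** * Decomposition of a permutation into disjoint cycles *)

Definition orbit_seq a o : seq 'I_d :=
  if [pick x in o] is Some x then traject a x #|o| else [::].

Lemma orbit_seqP a o : o \in porbits a ->
  exists2 x, o = porbit a x & orbit_seq a o = traject a x #|porbit a x|.
Proof.
case/imsetP=> x0 _ ->; rewrite /orbit_seq; case: pickP => [x xo|/(_ x0)].
  have xE : porbit a x0 = porbit a x by apply/eqP; rewrite eq_sym eq_porbit_mem.
  by exists x; rewrite -xE.
by rewrite porbit_id.
Qed.

Lemma mem_orbit_seq a o : o \in porbits a -> orbit_seq a o =i o.
Proof. by case/orbit_seqP=> x -> -> y; rewrite -porbit_traject. Qed.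

Lemma next_orbit_seq a o x : o \in porbits a -> x \in o ->
  next (orbit_seq a o) x = a x.
Proof.
move=> po xo; have xs : x \in orbit_seq a o by rewrite mem_orbit_seq.
suff C : fcycle a (orbit_seq a o) by have /eqP-> := next_cycle C xs.
have [z _ ->] := orbit_seqP po; have := iter_porbit a z.
case: #|_| => // n aK /=.
rewrite -[X in rcons _ X]aK iterSr -trajectSr; exact: fpath_traject.
Qed.

Lemma uniq_orbit_seqs a os : uniq os -> {subset os <= porbits a} ->
  uniq (flatten (map (orbit_seq a) os)).
Proof.
elim: os => //= o os IHos /andP[oos Uos] sos.
have po : o \in porbits a by rewrite sos ?mem_head.
have sos' : {subset os <= porbits a}.
  by move=> o' o'os; rewrite sos // inE o'os orbT.
rewrite cat_uniq IHos // andbT; apply/andP; split.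
  by have [z _ ->] := orbit_seqP po; exact: uniq_traject_porbit.
apply/hasPn=> x /flattenP[_ /mapP[o' o'os ->]].
rewrite (mem_orbit_seq (sos' _ o'os)) => xo'; rewrite (mem_orbit_seq po).
apply: contra oos => xo.
have orb o1 : o1 \in porbits a -> x \in o1 -> o1 = porbit a x.
  by case/imsetP=> z _ -> /=; rewrite -eq_porbit_mem => /eqP.
by rewrite (orb o) // -(orb o') ?sos'.
Qed.

Lemma cycle_decomposition a : exists cs,
  [/\ a = \prod_(c <- cs) cycle_perm c,
      uniq (flatten cs) & shape cs = cycle_type a].
Proof.
(* Filtered and sorted exactly as in [cycle_type], so that the shape is the type itself and not a
   rearrangement of it. *)
pose os := sort (relpre (fun o : {set 'I_d} => #|o|) geq)
  [seq o : {set 'I_d} <- enum (porbits a) | 1 < #|o|].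
have osE o : (o \in os) = (1 < #|o|) && (o \in porbits a).
  by rewrite mem_sort mem_filter mem_enum.
have sos : {subset os <= porbits a} by move=> o; rewrite osE => /andP[].
have Uos : uniq os by rewrite sort_uniq filter_uniq ?enum_uniq.
have U := uniq_orbit_seqs Uos sos.
exists (map (orbit_seq a) os); split=> //.
  apply/permP=> x; have px : porbit a x \in porbits a by exact: imset_f.
  have xx := porbit_id a x.
  have [ox|ox] := ltnP 1%N #|porbit a x|.
    rewrite (@prod_cycle_perm_in _ (orbit_seq a (porbit a x))) //.
    - by rewrite next_orbit_seq.
    - by apply: map_f; rewrite osE ox.
    - by rewrite mem_orbit_seq.
  rewrite prod_cycle_perm_out //.
    by have /card_le1_eqP := ox; apply=> //; rewrite -{1}[a]expg1 mem_porbit.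
  apply/negP=> /flattenP[_ /mapP[o oos ->]]; rewrite mem_orbit_seq ?sos //.
  move=> xo; move: oos; rewrite osE => /andP[+ /imsetP[z _ oz]].
  have -> : o = porbit a x.
    by rewrite oz; apply/eqP; rewrite eq_sym eq_porbit_mem -oz.
  by rewrite ltnNge ox.
rewrite /cycle_type filter_map sort_map /shape -map_comp; apply/eq_in_map => o.
by move=> /sos /orbit_seqP[z -> /= ->]; rewrite size_traject.
Qed.

Lemma canonical_rep_conj a : exists g, canonical_rep a = a ^ g.
Proof.
have [cs [aE U sh]] := cycle_decomposition a.
have [|cs' [cE U' sh']] := @canonical_of_typeE (cycle_type a).
  (* The nontrivial cycles involve at most d points altogether. *)
  rewrite -sh -size_flatten -(card_uniqP U) -[leqRHS]card_ord; exact: max_card.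
have [|g gE] := prod_cycle_perm_conj U U'; first by rewrite sh.
by exists g; rewrite {2}aE gE /canonical_rep cE.
Qed.

End CanonicalRepresentative.

Theorem theorem2p3 (d : nat) (hd : 2 <= d) (m : nat) (sigma_ : 'I_m -> 'S_d)
    (sbar s : Sigma d) (k : nat) (sigma : 'S_d)
    (hsbar : in_ST sbar)
    (hs : s = (\prod_(j < m) x_ (sigma_ j)) * sbar)
    (hsigma : sigma = (\prod_(j < m) canonical_rep (sigma_ j))^-1 * alpha s)
    (hgen : letter_group s = [set: 'S_d])
    (hln : ln sbar = k)
    (hk : 3 * (d - 1) <= k) :
  exists2 g : nat,
    (g%:R = (k%:R - (l_t sigma)%:R) / 2 - d%:R + 1 :> rat)%R &
    s = (\prod_(j < m) x_ (canonical_rep (sigma_ j)))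
        * regen (x_ sigma) * hurwitz_element d g.
Proof.
pose Z := [seq sigma_ j | j <- index_enum 'I_m].
have /in_STP[w0 Tw0 sbarE] := hsbar.
have szw0 : size w0 = k by rewrite -hln sbarE ln_word T_word_count.
have sE : s = word Z * word w0 by rewrite hs sbarE (wordE Z) big_map.
have gZ : gen (Z ++ w0) = [set: 'S_d].
  by rewrite -hgen sE wordM letter_group_word.
(* [sbar] is replaced by a word of the same length whose letters generate ['S_d] without the
   [sigma_ j]. *)
have [|w' [E [[Tw' TE] gE _ szE wE]]] := generating_squares Tw0 _ gZ.
  by rewrite szw0.
pose w1 := w' ++ doubles E.
have Tw1 : T_word w1 by rewrite all_cat Tw' T_double.
have szw1 : size w1 = k by rewrite -szw0 szE size_cat size_double.
have gw1 : gen w1 = [set: 'S_d].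
  apply/eqP; rewrite eqEsubset subsetT -gE; apply: sub_gen_word => b bE.
  by rewrite mem_cat mem_doubles bE orbT.
have [|w2 [Tw2 szw2 gw2 ZE]] :=
    conjugate_letters Z (@canonical_rep_conj d) Tw1 _ gw1.
  by rewrite szw1.
have [|n nE w2E] := generating_T_word_normal_form hd Tw2 _ gw2.
  by rewrite szw2 szw1.
rewrite sqE (wordM w') -/w1 in wE.
have s2E : s = (\prod_(j < m) x_ (canonical_rep (sigma_ j))) * word w2.
  by rewrite sE wE ZE (wordE (map _ Z)) !big_map.
(* Applying [alpha] identifies the product of the remaining transpositions. *)
have sw2 : sigma = \prod_(a <- w2) a.
  rewrite hsigma s2E alphaM alpha_word.
  suff -> : alpha (\prod_(j < m) x_ (canonical_rep (sigma_ j))) =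
      \prod_(j < m) canonical_rep (sigma_ j) by rewrite mulKg.
  elim/big_rec2: _ => [|j b c _ <-]; first by rewrite -word1 alpha_word big_nil.
  by rewrite alphaM alpha_x.
rewrite -sw2 in nE w2E; exists n; last by rewrite s2E w2E mulgA.
(* The genus is read off from the length count k = [l_t sigma] + 2(n + d - 1). *)
have dE : (d%:R = d.-1%:R + 1 :> rat)%R by rewrite GRing.natr1 (ltn_predK hd).
rewrite dE -szw1 -szw2 nE GRing.natrD GRing.natrM GRing.natrD.
by field.
Qed.
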